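(* Let $p\le n$ be positive integers. The map $\mathcal{R}^{\mathrm{qgeo}}:\mathrm{T}\,\mathrm{Sp}(2p,2n)\to\mathrm{Sp}(2p,2n)$ defined, for $X\in\mathrm{Sp}(2p,2n)$ and $Z\in\mathrm{T}_X\mathrm{Sp}(2p,2n)$, by $$\mathcal{R}^{\mathrm{qgeo}}_X(Z)=[X,\ Z]\,\exp\left(\begin{bmatrix} -J_{2p}W & J_{2p}Z^\top J_{2n}Z \\ I_{2p} & -J_{2p}W \end{bmatrix}\right)\begin{bmatrix} I_{2p} \\ 0 \end{bmatrix}e^{J_{2p}W},\qquad W=X^\top J_{2n}Z,$$ is a globally defined retraction on $\mathrm{Sp}(2p,2n)$.
   Context: For a positive integer $m$, $J_{2m}=\begin{bmatrix} 0 & I_m \\ -I_m & 0 \end{bmatrix}$. The symplectic Stiefel manifold is $\mathrm{Sp}(2p,2n)=\{X\in\mathbb{R}^{2n\times 2p}: X^\top J_{2n}X=J_{2p}\}$, an embedded submanifold of $\mathbb{R}^{2n\times 2p}$, with tangent space $\mathrm{T}_X\mathrm{Sp}(2p,2n)=\{Z\in\mathbb{R}^{2n\times 2p}: Z^\top J_{2n}X+X^\top J_{2n}Z=0\}$ and tangent bundle $\mathrm{T}\,\mathrm{Sp}(2p,2n)$. $\exp(A)$ and $e^A$ denote the matrix exponential. A globally defined retraction on a manifold $\mathcal{M}$ is a smooth map $\mathcal{R}:\mathrm{T}\mathcal{M}\to\mathcal{M}$, defined everywhere on the tangent bundle, such that for all $X\in\mathcal{M}$, with $\mathcal{R}_X$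 the restriction of $\mathcal{R}$ to $\mathrm{T}_X\mathcal{M}$: (1) $\mathcal{R}_X(0_X)=X$, where $0_X$ is the origin of $\mathrm{T}_X\mathcal{M}$; (2) $\frac{\mathrm{d}}{\mathrm{d}t}\mathcal{R}_X(tZ)|_{t=0}=Z$ for all $Z\in\mathrm{T}_X\mathcal{M}$. *)

(* Defs.v *)
From HB Require Import structures.
From mathcomp Require Import all_boot all_order all_algebra.
From mathcomp Require Import all_classical all_reals all_analysis.
Import Order.TTheory GRing.Theory Num.Theory.
Import numFieldNormedType.Exports.

Set Implicit Arguments.
Unset Strict Implicit.
Unset Printing Implicit Defensive.

Local Open Scope classical_set_scope.
Local Open Scope ring_scope.

(* The series converges for every A, so the limit never takes its default
   value. *)
Definition expmx (R : realType) (m : nat) (A : 'M[R]_m) : 'M[R]_m :=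
  limn (series (fun k : nat => (k`!%:R : R)^-1 *: A ^+ k)).

(* C^k on an open subset U of a finite-dimensional space: there, continuity of
   x |-> 'd f x is equivalent to continuity of x |-> 'd f x v for every v. *)
Fixpoint Ck_on (R : realType) (V W : normedModType R) (k : nat)
    (U : set V) (f : V -> W) : Prop :=
  match k with
  | 0%N => forall x, U x -> {for x, continuous f}
  | k'.+1 => (forall x, U x -> differentiable f x) /\
             forall v : V, Ck_on k' U (fun x => 'd f x v)
  end.

Definition Cinf_on (R : realType) (V W : normedModType R)
    (U : set V) (f : V -> W) : Prop :=
  forall k : nat, Ck_on k U f.

(* Smooth maps between embedded submanifolds D of V and N of W: maps that
   near each point of D extend to a smooth map on an open subset of V. *)
Definition smooth_map (R : realType) (V W : normedModType R)
    (D : set V) (N : set W) (f : V -> W) : Prop :=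
  (forall x, D x -> N (f x)) /\
  forall x, D x -> exists (U : set V) (g : V -> W),
    [/\ open U, U x, Cinf_on U g & forall y, U y -> D y -> g y = f y].

Definition tangent_bundle (R : realType) (V : normedModType R)
    (M : set V) (T : V -> set V) : set (V * V)%type :=
  [set XZ | M XZ.1 /\ T XZ.1 XZ.2].

(* M is an embedded submanifold of V with tangent spaces T X; only the values
   Ret X Z at X in M and Z in T X matter. *)
Definition is_global_retraction (R : realType) (V : normedModType R)
    (M : set V) (T : V -> set V) (Ret : V -> V -> V) : Prop :=
  [/\ smooth_map (tangent_bundle M T) M (fun XZ : V * V => Ret XZ.1 XZ.2),
      forall X, M X -> Ret X 0 = X &
      forall X Z, M X -> T X Z ->
        is_derive (0 : R) (1 : R) (fun t : R => Ret X (t *: Z)) Z].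

Definition Jmx (R : realType) (m : nat) : 'M[R]_(m + m) :=
  block_mx 0 1%:M (- 1%:M) 0.

Definition Sp (R : realType) (p n : nat) : set 'M[R]_(n + n, p + p) :=
  [set X | X^T *m Jmx R n *m X = Jmx R p].

Definition TSp (R : realType) (p n : nat) (X : 'M[R]_(n + n, p + p)) :
    set 'M[R]_(n + n, p + p) :=
  [set Z | Z^T *m Jmx R n *m X + X^T *m Jmx R n *m Z = 0].

Definition Rqgeo (R : realType) (p n : nat) (X Z : 'M[R]_(n + n, p + p)) :
    'M[R]_(n + n, p + p) :=
  let J := Jmx R p in
  let W : 'M[R]_(p + p) := X^T *m Jmx R n *m Z in
  row_mx X Z
  *m expmx (block_mx (- (J *m W)) (J *m Z^T *m Jmx R n *m Z)
                     1%:M         (- (J *m W)))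
  *m col_mx 1%:M 0
  *m expmx (J *m W).

Arguments Jmx R m : clear implicits.
Arguments Sp R p n : clear implicits.
Arguments TSp R p n : clear implicits.
Arguments Rqgeo R p n : clear implicits.

(* Main.v *)
Require Import Defs.
From mathcomp Require Import all_boot all_order all_algebra.
From mathcomp Require Import all_classical all_reals all_analysis.
From HB Require Import structures.
Import Order.TTheory GRing.Theory Num.Theory.
Import numFieldNormedType.Exports.

(** Put [M] for the block matrix in the definition of [Rqgeo] and [W] for
    [X^T J Z], so that [Rqgeo X Z = [X, Z] exp(M) [1; 0] exp(JW)].

    The image stays on the manifold because both exponentials preserve a
    bilinear form. On the tangent space [W] is symmetric and [K = Z^T J Z] is
    skew, the Gram matrix of [[X, Z]] for [J] is [S = [[J, W], [-W, K]]], and a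
    block computation gives [M^T S + S M = 0] ([block_mx_hamiltonian]). Hence
    [exp(M)^T S exp(M) = S], whose upper left block is [J]; likewise [JW]
    is Hamiltonian and [exp(JW)] is symplectic. Infinitesimal invariance
    integrates to invariance by differentiating
    [t |-> exp(tA) S exp(tB)] ([expmx_sylvester]).

    For the derivative at the origin, intertwining by [diag(1, t)] turns the
    block matrix attached to [t Z] into [t M], so [Rqgeo X (t Z)] is
    [[X, Z] exp(tM) [1; 0] exp(tJW)] ([Rqgeo_line]); the derivative at [0] is
    [[X, Z] M [1; 0] + X J W = (Z - X J W) + X J W = Z].

    Smoothness needs the exponential to be smooth on matrices. Everything about
    it follows from two facts: the bound by the scalar exponential
    ([expmx_norm_le]), and [A P = P B -> exp(A) P = P exp(B)]
    ([expmx_intertwine]). Applied to block triangular matrices, the second one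
    shows that the upper right block of [exp [[A, H], [0, B]]], written
    [expmx_dd A B H], is linear in [H] and satisfies
    [exp B - exp A = expmx_dd A B (B - A)]: it is a noncommutative divided
    difference. With the bound, this makes [exp] locally Lipschitz, then
    differentiable with differential [expmx_dd A A] ([is_diff_expmx]). Since this
    differential is again a block of an exponential, of a matrix depending
    affinely on the data, induction on the order of differentiability gives
    smoothness ([Cinf_expmx]). *)

Set Implicit Arguments.
Unset Strict Implicit.
Unset Printing Implicit Defensive.

Local Open Scope classical_set_scope.
Local Open Scope ring_scope.

(** * Norm and topology of matrices *)

(** Matrices are a complete uniform space and a normed module; joining the two
    structures makes absolutely convergent series of matrices converge. *)
HB.instance Definition _ (R : realType) (m n : nat) :=
  Uniform_isComplete.Build 'M[R]_(m, n) cauchy_cvg.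

Section MatrixNorm.
Variable R : realType.

Lemma mx_norm_entry_le m n (A : 'M[R]_(m, n)) i j : `|A i j| <= `|A|.
Proof.
rewrite [leRHS]/Num.Def.normr/= mx_normrE.
exact: (le_bigmax _ (fun ij => `|A ij.1 ij.2|) (i, j)).
Qed.

Lemma mx_norm_le m n (A : 'M[R]_(m, n)) r :
  0 <= r -> (forall i j, `|A i j| <= r) -> `|A| <= r.
Proof.
move=> r0 Ar; rewrite [leLHS]/Num.Def.normr/= mx_normrE.
by apply: bigmax_le => // -[i j] _; apply: Ar.
Qed.

Lemma mx_norm1_le m : `|1%:M : 'M[R]_m| <= 1.
Proof.
by apply: mx_norm_le => // i j; rewrite mxE; case: eqP; rewrite ?normr1 ?normr0.
Qed.

Lemma mx_normM_le l m n (A : 'M[R]_(l, m)) (B : 'M[R]_(m, n)) :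
  `|A *m B| <= m%:R * `|A| * `|B|.
Proof.
apply: mx_norm_le => [|i j]; first by rewrite !mulr_ge0.
rewrite mxE (le_trans (ler_norm_sum _ _ _))//.
rewrite (le_trans (ler_sum _ (G := fun=> `|A| * `|B|) _))//.
  by move=> k _; rewrite normrM ler_pM// mx_norm_entry_le.
by rewrite sumr_const card_ord -mulrA mulr_natl.
Qed.

(** The supremum norm is not submultiplicative, but [m%:R * `|_|] is; this is the
    quantity that the scalar exponential is evaluated at. *)
Lemma mx_normX_le m (A : 'M[R]_m) k : `|A ^+ k| <= (m%:R * `|A|) ^+ k.
Proof.
elim: k => [|k IHk]; first by rewrite !expr0 mx_norm1_le.
by rewrite !exprS (le_trans (mx_normM_le _ _))// ler_wpM2l// mulr_ge0.
Qed.

Lemma mx_norm_block_le m1 m2 n1 n2 (A : 'M[R]_(m1, n1)) (B : 'M[R]_(m1, n2))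
    (C : 'M[R]_(m2, n1)) (D : 'M[R]_(m2, n2)) r :
  `|A| <= r -> `|B| <= r -> `|C| <= r -> `|D| <= r -> `|block_mx A B C D| <= r.
Proof.
move=> Ar Br Cr Dr; apply: mx_norm_le => [|i j]; first exact: le_trans Ar.
by rewrite !mxE; case: splitP => i' _; rewrite mxE; case: splitP => j' _;
  apply: le_trans (mx_norm_entry_le _ _ _) _.
Qed.

Lemma mx_norm_ursubmx_le m1 m2 n1 n2 (A : 'M[R]_(m1 + m2, n1 + n2)) :
  `|ursubmx A| <= `|A|.
Proof. by apply: mx_norm_le => // i j; rewrite !mxE mx_norm_entry_le. Qed.

Lemma linear_lipschitz_continuous (V W : normedModType R)
    (f : {linear V -> W}) (c : R) :
  (forall x, `|f x| <= c * `|x|) -> continuous f.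
Proof.
move=> fc; apply/linear_bounded_continuous/linear_boundedP.
near=> r => x; apply: le_trans (fc x) _; apply: ler_wpM2r => [//|].
near: r; apply: nbhs_pinfty_ge; exact: num_real.
Unshelve. all: by end_near. Qed.

Lemma cvg_mx_entry (T : Type) (F : set_system T) (FF : Filter F) m n
    (f : T -> 'M[R]_(m, n)) (A : 'M[R]_(m, n)) :
  (forall i j, f x i j @[x --> F] --> A i j) -> f @ F --> A.
Proof.
move=> fA; apply/cvgrPdist_le => e e0; near=> x.
apply: mx_norm_le => [|i j]; first exact: ltW.
rewrite !mxE; move: i j; near: x.
apply: filter_forall => i; apply: filter_forall => j.
by move/cvgrPdist_le: (fA i j); apply.
Unshelve. all: by end_near. Qed.

Lemma mulmx_continuous l m n :
  continuous (fun p : 'M[R]_(l, m) * 'M[R]_(m, n) => p.1 *m p.2).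
Proof.
move=> p; apply: cvg_mx_entry => i j.
under eq_fun do rewrite mxE.
rewrite mxE; apply: cvg_big => [|k _]; first exact: add_continuous.
apply: cvgM.
  apply: (@continuous_comp _ _ _ fst (fun A : matrix _ _ _ => A i k)).
    exact: cvg_fst.
  exact: coord_continuous.
apply: (@continuous_comp _ _ _ snd (fun A : matrix _ _ _ => A k j)).
  exact: cvg_snd.
exact: coord_continuous.
Qed.

Lemma mulmxl_continuous l m n (A : 'M[R]_(l, m)) :
  continuous (mulmx A : 'M[R]_(m, n) -> 'M[R]_(l, n)).
Proof.
apply: (@linear_lipschitz_continuous _ _ (mulmx A) (m%:R * `|A|)) => x.
exact: mx_normM_le.
Qed.

Lemma mulmxr_continuous l m n (B : 'M[R]_(m, n)) :
  continuous (mulmxr B : 'M[R]_(l, m) -> 'M[R]_(l, n)).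
Proof.
apply: (@linear_lipschitz_continuous _ _ (mulmxr B) (m%:R * `|B|)) => x.
by rewrite mulrAC mx_normM_le.
Qed.

Lemma trmx_continuous m n : continuous (trmx : 'M[R]_(m, n) -> 'M[R]_(n, m)).
Proof.
apply: (@linear_lipschitz_continuous _ _ trmx 1) => x; rewrite mul1r.
by apply: mx_norm_le => // i j; rewrite mxE mx_norm_entry_le.
Qed.

Lemma ursubmx_continuous m1 m2 n1 n2 :
  continuous (ursubmx : 'M[R]_(m1 + m2, n1 + n2) -> 'M[R]_(m1, n2)).
Proof.
apply: (@linear_lipschitz_continuous _ _ (rsubmx \o usubmx) 1) => x.
rewrite mul1r; exact: mx_norm_ursubmx_le.
Qed.

End MatrixNorm.

(** * The matrix exponential *)

Definition expmx_coeff (R : realType) m (A : 'M[R]_m) : ('M[R]_m)^nat :=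
  fun k => (k`!%:R)^-1 *: A ^+ k.

Lemma expmx_coeff_norm_le (R : realType) m (A : 'M[R]_m) k :
  `|expmx_coeff A k| <= exp_coeff (m%:R * `|A|) k.
Proof.
rewrite normrZ ger0_norm ?invr_ge0// mulrC ler_wpM2r ?invr_ge0//.
exact: mx_normX_le.
Qed.

Lemma is_cvg_expmx_normed (R : realType) m (A : 'M[R]_m) :
  cvgn [normed series (expmx_coeff A)].
Proof.
apply: series_le_cvg (@is_cvg_series_exp_coeff _ (m%:R * `|A|)) => k /=.
- exact: normr_ge0.
- by rewrite exp_coeff_ge0// mulr_ge0.
- exact: expmx_coeff_norm_le.
Qed.

Arguments is_cvg_expmx_normed {R m} A.

Lemma cvg_expmx (R : realType) m (A : 'M[R]_m) :
  series (expmx_coeff A) @ \oo --> expmx A.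
Proof. exact: normed_cvg (is_cvg_expmx_normed A). Qed.

Arguments cvg_expmx {R m} A.

Lemma expmx_norm_le (R : realType) m (A : 'M[R]_m) r :
  m%:R * `|A| <= r -> `|expmx A| <= expR r.
Proof.
move=> Ar; rewrite (le_trans (lim_series_norm (is_cvg_expmx_normed A)))//.
apply: le_trans (_ : expR (m%:R * `|A|) <= _); last by rewrite ler_expR.
apply: lim_series_le => [||k].
- exact: (is_cvg_expmx_normed A).
- exact: (is_cvg_series_exp_coeff (m%:R * `|A|)).
- exact: expmx_coeff_norm_le.
Qed.

(** Each partial sum of the series intertwines, and multiplication by [P] is
    continuous. Most identities below are instances with a block matrix [P]. *)
Lemma expmx_intertwine (R : realType) m n (A : 'M[R]_m) (B : 'M[R]_n)
    (P : 'M[R]_(m, n)) :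
  A *m P = P *m B -> expmx A *m P = P *m expmx B.
Proof.
move=> AP; have AkP k : A ^+ k *m P = P *m B ^+ k.
  elim: k => [|k IHk]; first by rewrite !expr0 mul1mx mulmx1.
  rewrite !exprS -[A * _]/(A *m _) -[B * _]/(B *m _).
  by rewrite -mulmxA IHk !mulmxA AP.
have cA : mulmxr P \o series (expmx_coeff A) @ \oo --> expmx A *m P.
  apply: (@cvg_comp _ _ _ (series (expmx_coeff A)) (mulmxr P) _
    (nbhs (expmx A))).
    exact: cvg_expmx.
  exact: mulmxr_continuous.
have cB : mulmx P \o series (expmx_coeff B) @ \oo --> P *m expmx B.
  apply: (@cvg_comp _ _ _ (series (expmx_coeff B)) (mulmx P) _
    (nbhs (expmx B))).
    exact: cvg_expmx.
  exact: mulmxl_continuous.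
have E : mulmxr P \o series (expmx_coeff A) =
    mulmx P \o series (expmx_coeff B).
  apply/funext => k /=; rewrite /series/= mulmx_suml mulmx_sumr.
  by apply: eq_bigr => i _; rewrite -scalemxAl -scalemxAr AkP.
by rewrite E in cA; apply: (cvg_unique _ cA cB).
Qed.

Lemma expmx_tr (R : realType) m (A : 'M[R]_m) : expmx A^T = (expmx A)^T.
Proof.
have cA : trmx \o series (expmx_coeff A) @ \oo --> (expmx A)^T.
  apply: (@cvg_comp _ _ _ (series (expmx_coeff A)) trmx _ (nbhs (expmx A))).
    exact: cvg_expmx.
  exact: trmx_continuous.
have E : trmx \o series (expmx_coeff A) = series (expmx_coeff A^T).
  apply/funext => k /=; rewrite /series/= linear_sum; apply: eq_bigr => i _.
  rewrite linearZ/=; congr (_ *: _).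
  elim: i => [|i IHi]; first by rewrite !expr0 trmx1.
  by rewrite exprSr exprS -[_ * A]/(_ *m A) trmx_mul IHi.
by rewrite E in cA; apply: (cvg_unique _ (cvg_expmx _) cA).
Qed.

Lemma expmx0 (R : realType) m : expmx (0 : 'M[R]_m) = 1%:M.
Proof.
have c0 := cvg_expmx (0 : 'M[R]_m).
have E : [sequence series (expmx_coeff (0 : 'M[R]_m)) k.+1]_k = cst 1%:M.
  apply/funext => k; rewrite /series/= big_nat_recl//= big1 ?addr0.
    by rewrite /expmx_coeff fact0 invr1 scale1r expr0.
  move=> i _; rewrite /expmx_coeff exprS.
  by rewrite -[0 * _]/(0 *m _) mul0mx scaler0.
by rewrite -cvg_shiftS E in c0; apply: (cvg_unique _ c0 (cvg_cst _)).
Qed.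

(** * Exponentials of block triangular matrices *)

Section DividedDifference.
Variable R : realType.

(** The divided difference of the exponential, that is
    [\sum_k 1/k! \sum_(i + j = k - 1) A^i H B^j]; reading it off a block
    triangular exponential avoids handling these sums. *)
Definition expmx_dd m n (A : 'M[R]_m) (B : 'M[R]_n) (H : 'M[R]_(m, n)) :
  'M[R]_(m, n) := ursubmx (expmx (block_mx A H 0 B)).

Lemma expmx_block m n (A : 'M[R]_m) (B : 'M[R]_n) (H : 'M[R]_(m, n)) :
  expmx (block_mx A H 0 B) =
  block_mx (expmx A) (expmx_dd A B H) 0 (expmx B).
Proof.
set M := block_mx A H 0 B.
have : expmx M *m col_mx 1%:M 0 = col_mx 1%:M 0 *m expmx A.
  apply: expmx_intertwine.
  by rewrite mul_block_col mul_col_mx !mulmx0 !mulmx1 mul0mx mul1mx !addr0.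
have : expmx B *m row_mx 0 1%:M = row_mx 0 1%:M *m expmx M.
  apply: expmx_intertwine.
  by rewrite mul_row_block mul_mx_row !mulmx0 !mulmx1 !mul0mx mul1mx !add0r.
rewrite -[expmx M]submxK mul_row_block mul_mx_row mul_block_col mul_col_mx.
rewrite !mulmx0 !mulmx1 !mul0mx !mul1mx !addr0 !add0r.
move=> /eq_row_mx[_ <-] /eq_col_mx[-> ->].
by rewrite -/(expmx_dd A B H).
Qed.

(** The hypotheses say that [diag(P, Q)] intertwines the two block triangular
    matrices. *)
Lemma expmx_dd_natural m n m' n' (A : 'M[R]_m) (B : 'M[R]_n) (H : 'M[R]_(m, n))
    (A' : 'M[R]_m') (B' : 'M[R]_n') (H' : 'M[R]_(m', n'))
    (P : 'M[R]_(m, m')) (Q : 'M[R]_(n, n')) :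
  A *m P = P *m A' -> B *m Q = Q *m B' -> H *m Q = P *m H' ->
  expmx_dd A B H *m Q = P *m expmx_dd A' B' H'.
Proof.
move=> AP BQ HQ.
have : expmx (block_mx A H 0 B) *m block_mx P 0 0 Q =
       block_mx P 0 0 Q *m expmx (block_mx A' H' 0 B').
  apply: expmx_intertwine.
  by rewrite !mulmx_block !mulmx0 !mul0mx !addr0 !add0r AP BQ HQ.
rewrite !expmx_block !mulmx_block !mulmx0 !mul0mx !addr0 !add0r.
by case/eq_block_mx.
Qed.

(** Naturality suffices: [a *: H + K], [H] and [K] are the images of the column
    [[H; K]] under [[a, 1]], [[1, 0]] and [[0, 1]], all of which intertwine [A]
    with [diag(A, A)], and the first row is the corresponding combination of the
    other two. *)
Lemma expmx_dd_linear m n (A : 'M[R]_m) (B : 'M[R]_n) :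
  linear (expmx_dd A B).
Proof.
move=> a H K; pose AA := block_mx A 0 0 A.
have dd1 P L : A *m P = P *m AA -> L = P *m col_mx H K ->
    expmx_dd A B L = P *m expmx_dd AA B (col_mx H K).
  move=> AP LP; rewrite -[LHS]mulmx1; apply: expmx_dd_natural => //.
    by rewrite mulmx1 mul1mx.
  by rewrite mulmx1.
rewrite (dd1 (row_mx a%:M 1%:M)); last 2 first.
- rewrite mul_mx_row mul_row_block !mulmx0 mulmx1 mul1mx addr0 add0r.
  by rewrite scalar_mxC.
- by rewrite mul_row_col mul1mx mul_scalar_mx.
rewrite (dd1 (row_mx 1%:M 0) H); last 2 first.
- by rewrite mul_mx_row mul_row_block !mulmx0 !mul0mx mulmx1 mul1mx !addr0.
- by rewrite mul_row_col mul1mx mul0mx addr0.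
rewrite (dd1 (row_mx 0 1%:M) K); last 2 first.
- by rewrite mul_mx_row mul_row_block !mulmx0 !mul0mx mulmx1 mul1mx !add0r.
- by rewrite mul_row_col mul1mx mul0mx add0r.
rewrite scalemxAl -mulmxDl; congr (_ *m _).
by rewrite scale_row_mx add_row_mx scaler0 addr0 add0r scalemx1.
Qed.

HB.instance Definition _ m n (A : 'M[R]_m) (B : 'M[R]_n) :=
  GRing.isLinear.Build R 'M[R]_(m, n) 'M[R]_(m, n) _ (expmx_dd A B)
    (expmx_dd_linear A B).

(** The column [[1; 1]] intertwines [[[A, B - A], [0, B]]] with [B]. *)
Lemma expmxB m (A B : 'M[R]_m) : expmx B - expmx A = expmx_dd A B (B - A).
Proof.
have : expmx (block_mx A (B - A) 0 B) *m col_mx 1%:M 1%:M =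
       col_mx 1%:M 1%:M *m expmx B.
  apply: expmx_intertwine.
  by rewrite mul_block_col mul_col_mx !mulmx1 !mul1mx add0r subrKC.
rewrite expmx_block mul_block_col mul_col_mx !mulmx1 !mul1mx.
by move=> /eq_col_mx[<- _]; rewrite addrAC subrr add0r.
Qed.

(** By linearity [H] may be taken of norm [1], and then the block matrix is bounded
    by [r] as well. *)
Lemma expmx_dd_norm_le m n (A : 'M[R]_m) (B : 'M[R]_n) r (H : 'M[R]_(m, n)) :
  1 <= r -> `|A| <= r -> `|B| <= r ->
  `|expmx_dd A B H| <= expR ((m + n)%:R * r) * `|H|.
Proof.
move=> r1 Ar Br; have [->|H0] := eqVneq H 0.
  by rewrite linear0 !normr0 mulr0.
have nH0 : 0 < `|H| by rewrite normr_gt0.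
rewrite -[H in leLHS](scalerKV (lt0r_neq0 nH0)) linearZ normrZ normr_id mulrC.
rewrite ler_wpM2r//; apply: le_trans (mx_norm_ursubmx_le _) _.
apply: expmx_norm_le; rewrite ler_wpM2l//.
rewrite mx_norm_block_le// ?normr0 ?(le_trans _ r1)//.
by rewrite normrZ normfV normr_id mulVf ?lt0r_neq0.
Qed.

(** The series of [[[A, 1], [0, A]]] has upper right coefficients
    [k A^(k-1) / k!], which is the exponential series shifted by one. *)
Lemma expmx_dd1 m (A : 'M[R]_m) : expmx_dd A A 1%:M = expmx A.
Proof.
set M := block_mx A 1%:M 0 A.
have MX k : M ^+ k = block_mx (A ^+ k) (k%:R *: A ^+ k.-1) 0 (A ^+ k).
  elim: k => [|k IHk]; first by rewrite !expr0 scale0r -scalar_mx_block.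
  rewrite exprS -[M * _]/(M *m _) IHk mulmx_block.
  rewrite !mulmx0 !mul0mx !addr0 mul1mx add0r.
  rewrite [A ^+ k.+1]exprS -[A * _]/(A *m _); congr block_mx.
  rewrite -scalemxAr.
  case: k {IHk} => [|k]; first by rewrite scale0r add0r scale1r.
  rewrite -[A *m _]/(A * _) -exprS -[A ^+ k.+1 in X in _ + X]scale1r.
  by rewrite -scalerDl natr1.
have cM : ursubmx \o series (expmx_coeff M) @ \oo --> expmx_dd A A 1%:M.
  apply: (@cvg_comp _ _ _ (series (expmx_coeff M)) ursubmx _ (nbhs (expmx M))).
    exact: cvg_expmx.
  exact: ursubmx_continuous.
have E : [sequence (ursubmx \o series (expmx_coeff M)) k.+1]_k =
    series (expmx_coeff A).
  apply/funext => k /=; rewrite /series/= -[ursubmx _]/((rsubmx \o usubmx) _).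
  have urM i : rsubmx (usubmx (expmx_coeff M i)) =
      (i`!%:R)^-1 *: (i%:R *: A ^+ i.-1).
    rewrite [usubmx _]linearZ [LHS]linearZ /= MX; congr (_ *: _).
    exact: block_mxKur.
  rewrite linear_sum/= big_nat_recl//= urM scale0r scaler0 add0r.
  apply: eq_bigr => i _; rewrite urM scalerA factS natrM invfM mulrAC.
  by rewrite mulVf ?mul1r// pnatr_eq0.
have cA : series (expmx_coeff A) @ \oo --> expmx_dd A A 1%:M.
  by rewrite -E (cvg_shiftS (ursubmx \o series (expmx_coeff M))).
exact: (cvg_unique _ cA (cvg_expmx A)).
Qed.

Lemma expmx_dd_comm m (A C : 'M[R]_m) :
  A *m C = C *m A -> expmx_dd A A C = expmx A *m C.
Proof.
move=> AC; rewrite -[LHS]mul1mx -expmx_dd1.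
by apply/esym/expmx_dd_natural; rewrite ?mulmx1 ?mul1mx.
Qed.

End DividedDifference.

(** * Differentiability of the exponential *)

Section ExponentialDifferential.
Variable R : realType.

Lemma expmx_dd_continuous m n (A : 'M[R]_m) (B : 'M[R]_n) :
  continuous (expmx_dd A B).
Proof.
pose r := Num.max 1 (Num.max `|A| `|B|).
apply: (@linear_lipschitz_continuous _ _ _ _ (expR ((m + n)%:R * r))) => H.
by apply: expmx_dd_norm_le; rewrite !le_max ?lexx ?orbT.
Qed.

(** Applying [expmxB] once turns the remainder into a difference of two divided
    differences in the direction [H]; applying it again, to the block matrices that
    define them, extracts the second factor [H]. *)
Lemma expmx_taylor1_le m (A H : 'M[R]_m) r :
  1 <= r -> `|A| <= r -> `|A + H| <= r ->
  `|expmx (A + H) - expmx A - expmx_dd A A H| <=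
    expR (((m + m) + (m + m))%:R * r) * `|H| ^+ 2.
Proof.
move=> r1 Ar AHr; have [->|H0] := eqVneq H 0.
  by rewrite addr0 subrr linear0 subr0 !normr0 expr0n mulr0.
have nH0 : 0 < `|H| by rewrite normr_gt0.
rewrite expmxB addrAC subrr add0r.
have [K HK K1] : exists2 K, H = `|H| *: K & `|K| <= 1.
  exists (`|H|^-1 *: H); first by rewrite scalerKV// lt0r_neq0.
  by rewrite normrZ normfV normr_id mulVf ?lt0r_neq0.
have ddZ B : expmx_dd A B H = `|H| *: expmx_dd A B K by rewrite {1}HK linearZ.
rewrite !ddZ -scalerBr.
rewrite normrZ normr_id expr2 mulrCA ler_wpM2l//.
rewrite /expmx_dd -[_ - _]/(rsubmx (usubmx _) - rsubmx (usubmx _)).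
rewrite -!linearB.
apply: le_trans (mx_norm_ursubmx_le _) _; rewrite expmxB.
have K0 : `|K| <= r := le_trans K1 r1.
have r0 : 0 <= r := le_trans ler01 r1.
apply: le_trans (expmx_dd_norm_le _ r1 _ _) _;
  rewrite ?mx_norm_block_le ?normr0//.
rewrite ler_wpM2l ?expR_ge0// opp_block_mx add_block_mx.
by rewrite mx_norm_block_le ?subrr ?normr0// addrAC subrr add0r.
Qed.

Global Instance is_diff_expmx m (A : 'M[R]_m) :
  is_diff A (@expmx R m) (expmx_dd A A).
Proof.
have cdd := @expmx_dd_continuous m m A A.
have tay : @expmx R m \o shift A =
    cst (expmx A) + expmx_dd A A +o_ (0 : 'M[R]_m) id.
  apply/eqaddoP => _/posnumP[e].
  pose r := `|A| + 1.
  pose c := expR (((m + m) + (m + m))%:R * r).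
  near=> H.
  rewrite -[X in `|X|]/(expmx (H + A) - (expmx A + expmx_dd A A H)).
  rewrite [H + A]addrC opprD addrA.
  apply: le_trans (_ : c * `|H| ^+ 2 <= _).
    apply: expmx_taylor1_le.
    - by rewrite lerDr.
    - by rewrite lerDl.
    - rewrite (le_trans (ler_normD _ _))// lerD2l.
      by near: H; exact: (@nbhs0_le R 'M[R]_m 1 ltr01).
  rewrite expr2 mulrA ler_wpM2r//.
  rewrite mulrC -ler_pdivlMr ?expR_gt0//.
  near: H; apply: (@nbhs0_le R 'M[R]_m); by rewrite divr_gt0// expR_gt0.
have dE := diff_unique cdd tay.
by split; first (apply/diff_locallyP; rewrite dE).
Unshelve. all: by end_near. Qed.

End ExponentialDifferential.

(** * Smooth maps *)

Section Smoothness.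
Variable R : realType.
Implicit Types V W : normedModType R.

Lemma Cinf_differentiable V W (f : V -> W) x :
  Cinf_on setT f -> differentiable f x.
Proof. by move=> /(_ 1)[df _]; apply: df. Qed.

Lemma Cinf_diff V W (f : V -> W) v :
  Cinf_on setT f -> Cinf_on setT (fun x => 'd f x v).
Proof. by move=> fC k; have [_] := fC k.+1; apply. Qed.

Lemma Ck_cst V W k (c : W) : Ck_on k setT (cst c : V -> W).
Proof.
elim: k c => [|k IHk] c /=; first by move=> x _; exact: cst_continuous.
split=> [x _|v]; first exact: differentiable_cst.
rewrite (_ : (fun x => _) = cst 0)//; apply/funext => x.
by rewrite (diff_cst (c : W) x).
Qed.

Lemma Ck_linear V W k (f : {linear V -> W}) :
  continuous f -> Ck_on k setT f.
Proof.
move=> fc; case: k => [|k] /=; first by move=> x _; exact: fc.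
split=> [x _|v]; first exact: linear_differentiable.
rewrite (_ : (fun x => _) = cst (f v)); first exact: Ck_cst.
by apply/funext => x; rewrite diff_lin.
Qed.

Lemma Ck_linear_comp V W W' k (L : {linear W -> W'}) (f : V -> W) :
  continuous L -> Ck_on k setT f -> Ck_on k setT (L \o f).
Proof.
move=> Lc; elim: k f => [|k IHk] f /=.
  by move=> fc x xT; apply: continuous_comp; [exact: fc|exact: Lc].
move=> [df Cdf]; have dL y : differentiable L y by exact: linear_differentiable.
split=> [x xT|v]; first by apply: differentiable_comp => //; apply: df.
rewrite (_ : (fun x => _) = L \o (fun x => 'd f x v)); first exact: IHk.
by apply/funext => x; rewrite (diff_comp (df x I) (dL _)) diff_lin.
Qed.

Lemma Ck_add V W k (f g : V -> W) :
  Ck_on k setT f -> Ck_on k setT g -> Ck_on k setT (fun x => f x + g x).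
Proof.
elim: k f g => [|k IHk] f g /=.
  by move=> fc gc x xT; apply: continuousD; [exact: fc|exact: gc].
move=> [df Cdf] [dg Cdg].
split=> [x xT|v]; first by apply: differentiableD; [exact: df|exact: dg].
rewrite (_ : (fun x => _) = fun x => 'd f x v + 'd g x v); first exact: IHk.
by apply/funext => x; rewrite (diffD (df x I) (dg x I)).
Qed.

Global Instance is_diff_mulmx V l m n (f df : V -> 'M[R]_(l, m))
    (g dg : V -> 'M[R]_(m, n)) x : is_diff x f df -> is_diff x g dg ->
  is_diff x (fun y => f y *m g y) (fun v => f x *m dg v + df v *m g x).
Proof.
move=> fx gx.
have dB : is_diff (f x, g x)
    (fun q : 'M[R]_(l, m) * 'M[R]_(m, n) => q.1 *m q.2)
    (fun q => f x *m q.2 + q.1 *m g x).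
  have c := @mulmx_continuous R l m n.
  split; first exact: (@differentiable_bilin R _ _ _ (@mulmx R l m n) _ c).
  exact: (@diff_bilin R _ _ _ (@mulmx R l m n) (f x, g x) c).
exact: (is_diff_comp (is_diff_pair fx gx) dB).
Qed.

Lemma Cinf_cst V W (c : W) : Cinf_on setT (cst c : V -> W).
Proof. by move=> k; apply: Ck_cst. Qed.

Lemma Cinf_add V W (f g : V -> W) :
  Cinf_on setT f -> Cinf_on setT g -> Cinf_on setT (fun x => f x + g x).
Proof. by move=> fC gC k; apply: Ck_add. Qed.

(** The induction on the order runs over smooth factors rather than [C^k] ones, so
    that it applies to [f] and [g] themselves as well as to their differentials. *)
Lemma Cinf_mulmx V l m n (f : V -> 'M[R]_(l, m)) (g : V -> 'M[R]_(m, n)) :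
  Cinf_on setT f -> Cinf_on setT g -> Cinf_on setT (fun x => f x *m g x).
Proof.
move=> fC gC k; elim: k f g fC gC => [|k IHk] f g fC gC.
  move=> x _; apply: differentiable_continuous.
  have := differentiableP (Cinf_differentiable x fC).
  have := differentiableP (Cinf_differentiable x gC).
  by move=> ? ?; apply: ex_diff.
have dfg x : is_diff x (fun y => f y *m g y)
    (fun v => f x *m 'd g x v + 'd f x v *m g x).
  by apply: is_diff_mulmx; apply: differentiableP; apply: Cinf_differentiable.
split=> [x _|v]; first exact: ex_diff.
rewrite (_ : (fun x => _) = fun x => f x *m 'd g x v + 'd f x v *m g x).
  by apply: Ck_add; apply: IHk => //; apply: Cinf_diff.
by apply/funext => x; rewrite diff_val.
Qed.

Lemma Cinf_opp V W (f : V -> W) :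
  Cinf_on setT f -> Cinf_on setT (fun x => - f x).
Proof.
move=> fC k; apply: (@Ck_linear_comp _ _ _ _ -%R) => // x.
exact: opp_continuous.
Qed.

Lemma Cinf_row_mx V l m n (f : V -> 'M[R]_(l, m)) (g : V -> 'M[R]_(l, n)) :
  Cinf_on setT f -> Cinf_on setT g ->
  Cinf_on setT (fun x => row_mx (f x) (g x)).
Proof.
move=> fC gC; rewrite (_ : (fun x => _) = fun x =>
    f x *m row_mx 1%:M 0 + g x *m row_mx 0 1%:M).
  by apply: Cinf_add; apply: Cinf_mulmx => //; apply: Cinf_cst.
apply/funext => x.
by rewrite !mul_mx_row !mulmx0 !mulmx1 add_row_mx addr0 add0r.
Qed.

Lemma Cinf_col_mx V l m n (f : V -> 'M[R]_(m, l)) (g : V -> 'M[R]_(n, l)) :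
  Cinf_on setT f -> Cinf_on setT g ->
  Cinf_on setT (fun x => col_mx (f x) (g x)).
Proof.
move=> fC gC; rewrite (_ : (fun x => _) = fun x =>
    col_mx 1%:M 0 *m f x + col_mx 0 1%:M *m g x).
  by apply: Cinf_add; apply: Cinf_mulmx => //; apply: Cinf_cst.
apply/funext => x.
by rewrite !mul_col_mx !mul0mx !mul1mx add_col_mx addr0 add0r.
Qed.

Lemma Cinf_block_mx V m1 m2 n1 n2
    (f : V -> 'M[R]_(m1, n1)) (g : V -> 'M[R]_(m1, n2))
    (h : V -> 'M[R]_(m2, n1)) (i : V -> 'M[R]_(m2, n2)) :
  Cinf_on setT f -> Cinf_on setT g -> Cinf_on setT h -> Cinf_on setT i ->
  Cinf_on setT (fun x => block_mx (f x) (g x) (h x) (i x)).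
Proof. by move=> fC gC hC iC; apply: Cinf_col_mx; apply: Cinf_row_mx. Qed.

Lemma Cinf_trmx V m n (f : V -> 'M[R]_(m, n)) :
  Cinf_on setT f -> Cinf_on setT (fun x => (f x)^T).
Proof.
move=> fC k; apply: (@Ck_linear_comp _ _ _ _ trmx) => //.
exact: trmx_continuous.
Qed.

(** The differential of [exp o f] along [v] is the upper right block of
    [exp o F], where [F] is the block triangular matrix built from [f] and from
    its differential along [v]. As [F] is smooth, the order drops by one while the
    size of the matrices doubles, hence the induction over all sizes. *)
Lemma Cinf_expmx V m (f : V -> 'M[R]_m) :
  Cinf_on setT f -> Cinf_on setT (fun x => expmx (f x)).
Proof.
move=> fC k; elim: k m f fC => [|k IHk] m f fC.
  move=> x _; apply: differentiable_continuous.
  apply: (@differentiable_comp _ _ _ _ f); first exact: Cinf_differentiable.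
  exact: ex_diff.
have dfx x := differentiableP (Cinf_differentiable x fC).
split=> [x _|v].
  apply: (@differentiable_comp _ _ _ _ f); first exact: Cinf_differentiable.
  exact: ex_diff.
rewrite (_ : (fun x => _) = (rsubmx \o usubmx) \o
    (fun x => expmx (block_mx (f x) ('d f x v) 0 (f x)))).
  apply: Ck_linear_comp; first exact: ursubmx_continuous.
  apply: IHk; apply: Cinf_block_mx => //; first exact: Cinf_diff.
  exact: Cinf_cst.
apply/funext => x; rewrite (diff_comp (f := f) (g := @expmx R m)) //=.
by rewrite diff_val.
Qed.

End Smoothness.

(** * Invariance along one-parameter subgroups *)

Section OneParameterSubgroup.
Variable R : realType.

Lemma is_diff_derive (V W : normedModType R) (f df : V -> W) x v :
  is_diff x f df -> is_derive x v f (df v).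
Proof.
by move=> fx; split; [exact: diff_derivable|rewrite deriveE// diff_val].
Qed.

Global Instance is_diff_expmx_line m (A : 'M[R]_m) (t : R) :
  is_diff t (fun s : R => expmx (s *: A)) (fun h => h *: (expmx (t *: A) *m A)).
Proof.
have := is_diff_comp (is_diff_scalel t A) (is_diff_expmx (t *: A)).
move/is_diff_eq; apply; apply/funext => h /=.
rewrite expmx_dd_comm ?scalemxAr//.
by rewrite -!scalemxAl -!scalemxAr !scalerA mulrC.
Qed.

Lemma derive0_mx_cst m n (f : R -> 'M[R]_(m, n)) (s t : R) :
  (forall x : R, is_derive x (1 : R) f 0) -> f s = f t.
Proof.
move=> f0; apply/matrixP => i j.
apply: (@is_derive_0_is_cst R (fun x => f x i j)) => x.
have dfx : derivable f x (1 : R) by exact: ex_derive.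
split; first by move/derivable_mxP: dfx.
have /matrixP/(_ i j) := derive_mx dfx.
by rewrite derive_val !mxE.
Qed.

(** The curve [t |-> exp(tA) S exp(tB)] has derivative
    [exp(tA) (A S + S B) exp(tB) = 0]. *)
Lemma expmx_sylvester m n (A : 'M[R]_m) (S : 'M[R]_(m, n)) (B : 'M[R]_n) :
  A *m S + S *m B = 0 -> expmx A *m S *m expmx B = S.
Proof.
move=> ASB; pose f t := expmx (t *: A) *m S *m expmx (t *: B).
have : f 1 = f 0; last by rewrite /f !scale1r !scale0r !expmx0 mul1mx mulmx1.
apply: derive0_mx_cst => t.
have df := is_diff_mulmx (is_diff_mulmx (is_diff_expmx_line A t)
  (is_diff_cst S t)) (is_diff_expmx_line B t).
have := is_diff_derive (1 : R) df; rewrite /= !scale1r mulmx0 add0r.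
rewrite (_ : _ + _ = 0)//.
have -> : expmx (t *: B) *m B = B *m expmx (t *: B).
  by apply: expmx_intertwine; rewrite -scalemxAl -scalemxAr.
rewrite !mulmxA -mulmxDl -!mulmxA -mulmxDr addrC ASB.
by rewrite mulmx0 mul0mx.
Qed.

(** An element of the Lie algebra of the group preserving the form [S] exponentiates
    into that group. *)
Lemma expmx_isometry m (A S : 'M[R]_m) :
  A^T *m S + S *m A = 0 -> (expmx A)^T *m S *m expmx A = S.
Proof. by rewrite -expmx_tr; apply: expmx_sylvester. Qed.

End OneParameterSubgroup.

(** * The quasi-geodesic retraction *)

Section QuasiGeodesic.
Variables (R : realType) (p n : nat).
Implicit Types X Z : 'M[R]_(n + n, p + p).

Lemma trmx_Jmx m : (Jmx R m)^T = - Jmx R m.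
Proof.
by rewrite tr_block_mx opp_block_mx !trmx0 linearN/= trmx1 !oppr0 opprK.
Qed.

Lemma mulmx_JJ m : Jmx R m *m Jmx R m = - 1%:M.
Proof.
rewrite mulmx_block !mulmx0 !mul0mx !mulmx1 !mul1mx !addr0 !add0r.
by rewrite scalar_mx_block opp_block_mx oppr0.
Qed.

Definition qgeo_gen X Z : 'M[R]_((p + p) + (p + p)) :=
  let JW := Jmx R p *m (X^T *m Jmx R n *m Z) in
  block_mx (- JW) (Jmx R p *m Z^T *m Jmx R n *m Z) 1%:M (- JW).

(** The matrix [D = diag(1, t)] satisfies [(t M) D = D M_t], where [M_t] is the
    generator attached to [t *: Z]. Intertwining through [D], instead of conjugating,
    covers [t = 0]. *)
Lemma Rqgeo_line X Z (t : R) : Rqgeo R p n X (t *: Z) =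
  row_mx X Z *m expmx (t *: qgeo_gen X Z) *m col_mx 1%:M 0
  *m expmx (t *: (Jmx R p *m (X^T *m Jmx R n *m Z))).
Proof.
pose D : 'M[R]_((p + p) + (p + p)) := block_mx 1%:M 0 0 t%:M.
have XD : row_mx X (t *: Z) = row_mx X Z *m D.
  by rewrite mul_row_block !mulmx0 mulmx1 addr0 add0r mul_mx_scalar.
have D1 : D *m col_mx 1%:M 0 = col_mx 1%:M 0.
  by rewrite mul_block_col !mulmx0 mul0mx mulmx1 !addr0.
have DM : t *: qgeo_gen X Z *m D = D *m qgeo_gen X (t *: Z).
  have tr_tZ : (t *: Z)^T = t *: Z^T by rewrite linearZ.
  rewrite /qgeo_gen tr_tZ scale_block_mx !mulmx_block -!scalemxAr -!scalemxAl.
  rewrite !mulmx0 !mul0mx !mulmx1 !mul1mx !addr0 !add0r.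
  rewrite !mul_mx_scalar mul_scalar_mx !scalerN !scaler0 !addr0 add0r.
  by rewrite scalemx1.
rewrite /Rqgeo -/(qgeo_gen X (t *: Z)) XD -(mulmxA (row_mx X Z) D).
rewrite -(expmx_intertwine DM) -!mulmxA (mulmxA D) D1 !mulmxA.
by rewrite -!scalemxAr.
Qed.

(** With [W = X^T J Z] and [K = Z^T J Z], the second block matrix is the Gram
    matrix of [[X, Z]]: the generator lies in the Lie algebra of the group
    preserving that form. *)
Lemma block_mx_hamiltonian m (J W K : 'M[R]_m) :
  J *m J = - 1%:M -> J^T = - J -> W^T = W -> K^T = - K ->
  let M := block_mx (- (J *m W)) (J *m K) 1%:M (- (J *m W)) in
  M^T *m block_mx J W (- W) K + block_mx J W (- W) K *m M = 0.
Proof.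
move=> JJ JT WT KT M.
have JWT : (J *m W)^T = - (W *m J) by rewrite trmx_mul WT JT mulmxN.
have JKT : (J *m K)^T = K *m J by rewrite trmx_mul KT JT mulmxN mulNmx opprK.
rewrite tr_block_mx linearN/= JWT opprK JKT trmx1 !mulmx_block add_block_mx.
rewrite !(mulmx1, mul1mx, mulmxN, mulNmx, opprK) !mulmxA.
rewrite JJ -!(mulmxA _ J J) JJ !(mulmxN, mulNmx, mulmx1, mul1mx, opprK).
have addNN (A B : 'M[R]_m) : A + B + (- B - A) = 0.
  by rewrite -opprD [B + A]addrC subrr.
have addNN' (A B : 'M[R]_m) : - B - A + (A + B) = 0 by rewrite addrC addNN.
by rewrite !addNN !addNN' block_mx0.
Qed.

(** [exp(M)] preserves the Gram matrix of [[X, Z]], so the first [2p] columns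
    of [[X, Z] exp(M)] have the Gram matrix [J] of [X]; [exp(JW)] preserves
    [J]. *)
Lemma Rqgeo_Sp X Z : Sp R p n X -> TSp R p n X Z -> Sp R p n (Rqgeo R p n X Z).
Proof.
rewrite /Sp /TSp /= => XSp ZT.
set J := Jmx R p; set Jn := Jmx R n; set W := X^T *m Jn *m Z.
have ZX : Z^T *m Jn *m X = - W.
  by apply/eqP; rewrite -addr_eq0 ZT.
have WT : W^T = W.
  by rewrite /W !trmx_mul trmxK trmx_Jmx mulNmx mulmxN mulmxA ZX opprK.
set K := Z^T *m Jn *m Z.
have KT : K^T = - K.
  by rewrite /K !trmx_mul trmxK trmx_Jmx mulNmx mulmxN mulmxA.
have SE : (row_mx X Z)^T *m Jn *m row_mx X Z = block_mx J W (- W) K.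
  by rewrite tr_row_mx mul_col_mx mul_col_row XSp ZX.
pose M := qgeo_gen X Z.
have MS : M^T *m block_mx J W (- W) K + block_mx J W (- W) K *m M = 0.
  have -> : M = block_mx (- (J *m W)) (J *m K) 1%:M (- (J *m W)).
    by rewrite /M /qgeo_gen /K !mulmxA.
  by apply: block_mx_hamiltonian => //; [exact: mulmx_JJ|exact: trmx_Jmx].
pose e := expmx (J *m W).
have eJ : e^T *m J *m e = J.
  apply: expmx_isometry; rewrite trmx_mul WT trmx_Jmx mulmxN mulNmx.
  rewrite -[W *m J *m J]mulmxA (mulmxA J J W) mulmx_JJ.
  by rewrite mulmxN mulNmx mulmx1 mul1mx opprK subrr.
have ME := expmx_isometry MS.
rewrite /Rqgeo -/J -/Jn -/W -[block_mx _ _ _ _]/M -/e !trmx_mul.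
rewrite -[RHS]eJ -!mulmxA; congr (_ *m _); rewrite !mulmxA; congr (_ *m _).
rewrite -!mulmxA (mulmxA _ Jn) (mulmxA _ (row_mx X Z)) SE.
rewrite (mulmxA (expmx M)^T) (mulmxA _ (expmx M)) ME.
rewrite tr_col_mx trmx1 trmx0 mul_block_col mul_row_col.
by rewrite !mulmx0 mul0mx mulmx1 mul1mx !addr0.
Qed.

Lemma is_derive_Rqgeo X Z :
  is_derive (0 : R) (1 : R) (fun t : R => Rqgeo R p n X (t *: Z)) Z.
Proof.
set JW := Jmx R p *m (X^T *m Jmx R n *m Z).
rewrite (_ : (fun t => _) = fun t : R => row_mx X Z
    *m expmx (t *: qgeo_gen X Z) *m col_mx 1%:M 0 *m expmx (t *: JW)); last first.
  by apply/funext => t; apply: Rqgeo_line.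
have dM := is_diff_expmx_line (qgeo_gen X Z) (0 : R).
have dW := is_diff_expmx_line JW (0 : R).
have d1 := is_diff_mulmx (is_diff_mulmx (is_diff_mulmx
  (is_diff_cst (row_mx X Z) (0 : R)) dM)
  (is_diff_cst (col_mx 1%:M 0) (0 : R))) dW.
have := is_diff_derive (1 : R) d1.
(* The differentials of the two constant factors are the zero function. *)
rewrite /= !scale1r !scale0r !expmx0 !mul1mx !mulmx1 mulmx0 add0r addr0.
rewrite (_ : _ *m JW + _ = Z)//.
rewrite -[X in _ + X]mulmxA mul_row_col mulmx1 mulmx0 addr0 mul_block_col.
rewrite mul_row_col !mulmx0 !mulmx1 !addr0 -/JW mulmxN addrA subrr add0r.
by rewrite mulmx1.
Qed.

Lemma Rqgeo0 X : Rqgeo R p n X 0 = X.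
Proof.
rewrite -(scale0r (0 : 'M[R]_(n + n, p + p))) Rqgeo_line !scale0r !expmx0.
by rewrite !mulmx1 mul_row_col mulmx1 mul0mx addr0.
Qed.

Lemma Cinf_Rqgeo :
  Cinf_on setT (fun XZ : 'M[R]_(n + n, p + p) * 'M[R]_(n + n, p + p) =>
    Rqgeo R p n XZ.1 XZ.2).
Proof.
have C1 : Cinf_on setT
    (fst : 'M[R]_(n + n, p + p) * 'M[R]_(n + n, p + p) -> _).
  by move=> k; apply: (@Ck_linear _ _ _ k fst) => x; exact: cvg_fst.
have C2 : Cinf_on setT
    (snd : 'M[R]_(n + n, p + p) * 'M[R]_(n + n, p + p) -> _).
  by move=> k; apply: (@Ck_linear _ _ _ k snd) => x; exact: cvg_snd.
have C0 := Cinf_cst.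
rewrite /Rqgeo.
by repeat first [exact: C1 | exact: C2 | exact: C0 | apply: Cinf_mulmx
  | apply: Cinf_row_mx | apply: Cinf_expmx | apply: Cinf_block_mx
  | apply: Cinf_opp | apply: Cinf_trmx].
Qed.

End QuasiGeodesic.

Theorem lemma5p1 (R : realType) (p n : nat) (hp : (0 < p)%N) (hpn : (p <= n)%N) :
  is_global_retraction (Sp R p n) (TSp R p n) (Rqgeo R p n).
Proof.
split.
- split=> [[X Z] [/= XSp ZT]|XZ _]; first exact: Rqgeo_Sp.
  (* The formula makes sense, and is smooth, on the whole ambient space. *)
  exists setT, (fun XZ => Rqgeo R p n XZ.1 XZ.2); split => //.
    exact: openT.
  exact: Cinf_Rqgeo.
- by move=> X _; apply: Rqgeo0.
- by move=> X Z _ _; apply: is_derive_Rqgeo.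
Qed.
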